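(* Let the internal energy density $\rho e$ of a single-component fluid be given as a function $(\rho e)(\rho,p)$ of density $\rho$ and pressure $p$, differentiable in $\rho$, and let $\left.\frac{\partial \rho e}{\partial\rho}\right|_p$ denote its partial derivative with respect to $\rho$ at fixed $p$. Consider states with one common pressure $p$ and one common velocity. Let $\rho_{\rm avg}(\bm{u}_L,\bm{u}_R)$ and $(\rho e)_{\rm avg}(\bm{u}_L,\bm{u}_R)$ be consistent and symmetric two-point approximations of $\rho$ and $\rho e$ on such states, and write $\rho_{i+1/2}=\rho_{\rm avg}(\bm{u}_i,\bm{u}_{i+1})$, $\rho_{i-1/2}=\rho_{\rm avg}(\bm{u}_{i-1},\bm{u}_i)$, $\rho e_{i+1/2}=(\rho e)_{\rm avg}(\bm{u}_i,\bm{u}_{i+1})$, $\rho e_{i-1/2}=(\rho e)_{\rm avg}(\bm{u}_{i-1},\bm{u}_i)$. Then the pressure equilibrium condition $$\left.\frac{\partial \rho e}{\partial\rho}\right|_{p,\bm{u}_i}\left(\rho_{i+1/2}-\rho_{i-1/2}\right)=\rho e_{i+1/2}-\rho e_{i-1/2}$$ holds for all such states $\bm{u}_{i-1},\bm{u}_i,\bm{u}_{i+1}$ if and only if, for all such states $\bm{u}_L,\bm{u}_R$, $$\left[\!\left[\left.\frac{\partial \rho e}{\partial\rho}\right|_{p}\right]\!\right]\rho_{\rm avg}=\left[\!\left[\left.\frac{\partial \rho e}{\partial\rho}\right|_{p}\rho\right]\!\right]-[\![\rho e]\!]$$ and $$(\rho e)_{\rm avg}=\{\!\{\rho e\}\!\}+\left\{\!\!\left\{\left.\frac{\partial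 \rho e}{\partial\rho}\right|_{p}\right\}\!\!\right\}\rho_{\rm avg}-\left\{\!\!\left\{\left.\frac{\partial \rho e}{\partial\rho}\right|_{p}\rho\right\}\!\!\right\}.$$
   Context: For a quantity $a$ depending on the state and a pair of states $(\bm{u}_L,\bm{u}_R)$, with $a_L=a(\bm{u}_L)$ and $a_R=a(\bm{u}_R)$, the average and jump are $\{\!\{a\}\!\}=\frac12(a_L+a_R)$ and $[\![a]\!]=a_L-a_R$. A two-point approximation $a_{\rm avg}(\bm{u}_L,\bm{u}_R)$ of $a$ is consistent if $a_{\rm avg}(\bm{u},\bm{u})=a(\bm{u})$ and symmetric if $a_{\rm avg}(\bm{u}_L,\bm{u}_R)=a_{\rm avg}(\bm{u}_R,\bm{u}_L)$ for all states. The notation $\left.\frac{\partial \rho e}{\partial\rho}\right|_{p,\bm{u}_i}$ means the partial derivative at fixed pressure evaluated at the state $\bm{u}_i$. Since pressure and velocity are common to all states considered, each state is determined by its density, ranging over the admissible densities at that pressure. *)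

(* Defs.v *)
From mathcomp Require Import all_boot all_order all_algebra.
From mathcomp Require Import boolp classical_sets reals.
From mathcomp Require Import topology normedtype derive.

Set Implicit Arguments.
Unset Strict Implicit.
Unset Printing Implicit Defensive.

Import Order.TTheory GRing.Theory Num.Theory.
Import numFieldNormedType.Exports.

Local Open Scope classical_set_scope.
Local Open Scope ring_scope.

(* A single-component fluid state in primitive variables, in d space
   dimensions. *)
Record state (R : realType) (d : nat) := State {
  density : R;
  velocity : 'rV[R]_d;
  pressure : R }.

Section Quantities.
Context {R : realType} {d : nat}.
Local Notation state := (state R d).

Definition mean (a : state -> R) (uL uR : state) : R := (a uL + a uR) / 2.

Definition jump (a : state -> R) (uL uR : state) : R := a uL - a uR.

Definition consistent_on (S : set state) (a : state -> R)
    (a_avg : state -> state -> R) : Prop :=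
  forall u, S u -> a_avg u u = a u.

Definition symmetric_on (S : set state) (a_avg : state -> state -> R) : Prop :=
  forall uL uR, S uL -> S uR -> a_avg uL uR = a_avg uR uL.

(* [adm q] is the set of densities admissible at pressure q. *)
Definition equilibrium_states (adm : R -> set R) (p : R) (v : 'rV[R]_d) :
    set state :=
  [set u | [/\ adm (pressure u) (density u), pressure u = p & velocity u = v]].

(* The equation of state [rhoe] takes the density, then the pressure.  It is a
   total function, of which only the germs at admissible densities matter. *)
Definition differentiable_in_density (adm : R -> set R) (rhoe : R -> R -> R) :
    Prop :=
  forall p rho, adm p rho -> derivable (fun r => rhoe r p) rho 1.

Definition energy (rhoe : R -> R -> R) (u : state) : R :=
  rhoe (density u) (pressure u).

Definition denergy_drho (rhoe : R -> R -> R) (u : state) : R :=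
  ((fun r => rhoe r (pressure u))^`()%classic) (density u).

(* [um], [u], [up] stand for the states in the cells i-1, i, i+1. *)
Definition pressure_equilibrium (S : set state) (rhoe : R -> R -> R)
    (rho_avg rhoe_avg : state -> state -> R) : Prop :=
  forall um u up, S um -> S u -> S up ->
    denergy_drho rhoe u * (rho_avg u up - rho_avg um u)
      = rhoe_avg u up - rhoe_avg um u.

End Quantities.

(* Main.v *)
Require Import Defs.
From mathcomp Require Import all_boot all_order all_algebra.
From mathcomp Require Import boolp classical_sets reals.
From mathcomp Require Import topology normedtype derive.
From mathcomp Require Import lra.

(** At the common pressure, plot energy density against density. The tangent
line to this curve at a state [u] is the set of points [(x, y)] with
[y - e u = D u * (x - r u)], where [r], [e] and [D] are density, energy and
slope. For a pair of states, the jump and mean conditions are the difference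
and the half-sum of the two equations saying that the point
[(rho_avg uL uR, rhoe_avg uL uR)] lies on the tangent lines at [uL] and at [uR]
([on_both_tangents]).

Pressure equilibrium is the same condition. For three states [um], [u], [up] it
says that the averaged points of [(um, u)] and [(u, up)] differ by a multiple of
the tangent direction [(1, D u)]. If both points lie on the tangent line at [u], that is
immediate. Conversely, by consistency the averaged point of [(u, u)] is the
point of the curve at [u], so the triples [(uL, uL, uR)] and [(uL, uR, uR)] put
the averaged point of [(uL, uR)] on the tangent lines at [uL] and at [uR]. *)

Set Implicit Arguments.
Unset Strict Implicit.
Unset Printing Implicit Defensive.

Import Order.TTheory GRing.Theory Num.Theory.
Import numFieldNormedType.Exports.

Local Open Scope classical_set_scope.
Local Open Scope ring_scope.

(** Passing from two equations to their difference and half-sum is invertible,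
as 2 is nonzero; products such as [D uL * r uL] are opaque constants here. *)
Lemma on_both_tangents (R : realType) (d : nat) (D r e : state R d -> R)
    (uL uR : state R d) (x y : R) :
  (y - e uL = D uL * (x - r uL) /\ y - e uR = D uR * (x - r uR))
  <->
  (jump D uL uR * x = jump (fun u => D u * r u) uL uR - jump e uL uR
   /\ y = mean e uL uR + mean D uL uR * x - mean (fun u => D u * r u) uL uR).
Proof. by rewrite /jump /mean; split=> -[h1 h2]; split; lra. Qed.

Theorem mainTheorem2 (R : realType) (d : nat)
    (adm : R -> set R) (rhoe : R -> R -> R)
    (rhoe_diff : differentiable_in_density adm rhoe)
    (p : R) (v : 'rV[R]_d)
    (rho_avg rhoe_avg : state R d -> state R d -> R)
    (rho_consistent :
      consistent_on (equilibrium_states adm p v) (@density R d) rho_avg)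
    (rho_symmetric : symmetric_on (equilibrium_states adm p v) rho_avg)
    (rhoe_consistent :
      consistent_on (equilibrium_states adm p v) (energy rhoe) rhoe_avg)
    (rhoe_symmetric : symmetric_on (equilibrium_states adm p v) rhoe_avg) :
  pressure_equilibrium (equilibrium_states adm p v) rhoe rho_avg rhoe_avg
  <->
  (forall uL uR : state R d,
     equilibrium_states adm p v uL -> equilibrium_states adm p v uR ->
     jump (denergy_drho rhoe) uL uR * rho_avg uL uR
       = jump (fun u => denergy_drho rhoe u * density u) uL uR
         - jump (energy rhoe) uL uR
     /\
     rhoe_avg uL uR
       = mean (energy rhoe) uL uR
         + mean (denergy_drho rhoe) uL uR * rho_avg uL uR
         - mean (fun u => denergy_drho rhoe u * density u) uL uR).
Proof.
split=> [eq_cond uL uR SL SR|avg_cond um u up Sm S Sp].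
  apply/on_both_tangents.
  have := eq_cond uL uL uR SL SL SR.
  have := eq_cond uL uR uR SL SR SR.
  rewrite !rho_consistent // !rhoe_consistent // => eqR eqL.
  by split; lra.
have /on_both_tangents [_ tangent_m] := avg_cond um u Sm S.
have /on_both_tangents [tangent_p _] := avg_cond u up S Sp.
by lra.
Qed.
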